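(* For all $n\ge 2$ we have $$\sum_{\pi\in F_n(123)} q^{\operatorname{inv}(\pi)}t^{\operatorname{lrmax}(\pi)}r^{\operatorname{afterone}(\pi)} = t\sum_{s=0}^{n-2} q^{s^2+s-ns+\binom n2}\genfrac{[}{]}{0pt}{}{n-2}{s}_q r^s + t^2\sum_{s=1}^{n-1} q^{s^2-ns+\binom n2}\genfrac{[}{]}{0pt}{}{n-2}{s-1}_q r^s .$$ In particular, $$\sum_{\pi\in F_n(123)} q^{\operatorname{inv}(\pi)}r^{\operatorname{afterone}(\pi)} = \sum_{s=0}^{n-1} q^{s^2-ns+\binom n2}\genfrac{[}{]}{0pt}{}{n-1}{s}_q r^s .$$
   Context: A Fishburn permutation is a permutation $\pi$ (in one-line notation) with no subsequence $\pi_j,\pi_{j+1},\pi_k$ such that $j+1<k$, $\pi_j=\pi_k+1$, and $\pi_{j+1}>\pi_j$. $F_n(123)$ is the set of Fishburn permutations of length $n$ with no increasing subsequence of length three (i.e. avoiding the classical pattern $123$). $\operatorname{inv}(\pi)$ is the number of pairs $(j,k)$ with $j<k$ and $\pi_j>\pi_k$; $\operatorname{lrmax}(\pi)$ is the number of left-to-right maxima (entries greater than all entries to their left); $\operatorname{afterone}(\pi)$ is the number of entries of $\pi$ to the right of the entry $1$. The $q$-binomial coefficient is $\genfrac{[}{]}{0pt}{}{n}{m}_q=\sum_{\alpha} q^{\operatorname{inv}(\alpha)}$, summed over binary sequences $\alpha$ of length $n$ with exactly $m$ ones, where $\operatorname{inv}(\alpha)$ is the number of pairs $j<k$ with $\alpha(j)=1$,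 $\alpha(k)=0$. *)

(* Defs.v *)
From HB Require Import structures.
From mathcomp Require Import all_boot all_order all_fingroup all_algebra.
Set Implicit Arguments.
Unset Strict Implicit.
Unset Printing Implicit Defensive.
Import GRing.Theory.
Local Open Scope ring_scope.

(* A permutation of length n is an element p of 'S_n; positions and values are
   both numbered from 0, so the entry called 1 in one-line notation is the
   value 0 here, and the entry in position i.+1 is (p i).+1. *)

Definition fishburn (n : nat) (p : 'S_n) : bool :=
  ~~ [exists j : 'I_n, exists j1 : 'I_n, exists k : 'I_n,
        [&& j1 == j.+1 :> nat, (j1 < k)%N,
            p j == (p k).+1 :> nat & (p j < p j1)%N]].

Definition avoids123 (n : nat) (p : 'S_n) : bool :=
  ~~ [exists i : 'I_n, exists j : 'I_n, exists k : 'I_n,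
        [&& (i < j)%N, (j < k)%N, (p i < p j)%N & (p j < p k)%N]].

Definition fishburn123 (n : nat) : {set 'S_n} :=
  [set p : 'S_n | fishburn p && avoids123 p].

Definition num_inv (n : nat) (p : 'S_n) : nat :=
  #|[set x : 'I_n * 'I_n | (x.1 < x.2)%N && (p x.2 < p x.1)%N]|.

Definition lrmax (n : nat) (p : 'S_n) : nat :=
  #|[set i : 'I_n | [forall j : 'I_n, (j < i)%N ==> (p j < p i)%N]]|.

Definition afterone (n : nat) (p : 'S_n) : nat :=
  #|[set i : 'I_n | [exists j : 'I_n, (p j == 0%N :> nat) && (j < i)%N]]|.

Definition binseq_ones (n : nat) (a : {ffun 'I_n -> bool}) : nat :=
  #|[set i : 'I_n | a i]|.

Definition binseq_inv (n : nat) (a : {ffun 'I_n -> bool}) : nat :=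
  #|[set x : 'I_n * 'I_n | [&& (x.1 < x.2)%N, a x.1 & ~~ a x.2]]|.

Definition qbinomial (R : comNzRingType) (q : R) (n m : nat) : R :=
  \sum_(a : {ffun 'I_n -> bool} | binseq_ones a == m) q ^+ binseq_inv a.

(* The exponents s^2 + s - n s + binomial(n, 2) and s^2 - n s + binomial(n, 2)
   are natural numbers; written with truncated subtraction of n s, nothing is
   lost. *)
Lemma qexp_no_truncation (n s : nat) : (n * s <= s ^ 2 + 'C(n, 2))%N.
Proof.
have [le_ns|/ltnW/subnK <-] := leqP n s.
  by apply: leq_trans (leq_addr _ _); rewrite -mulnn leq_mul2r le_ns orbT.
rewrite mulnDl mulnn addnC leq_add2l.
elim: (n - s)%N => [|d IHd]; first by rewrite mul0n.
by rewrite mulSn addSn binS bin1 addnC leq_add // leq_addl.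
Qed.

(* Main.v *)
Require Import Defs.
From HB Require Import structures.
From mathcomp Require Import all_boot all_order all_fingroup all_algebra.
From mathcomp Require Import zify ring.
Import GRing.Theory.
Local Open Scope ring_scope.

(** If [pi_j < pi_(j+1)] in a 123-avoiding Fishburn permutation and [pi_j] is
    not the minimum, then the entry [pi_j - 1] lies either to the right of
    position [j+1] (the Fishburn pattern) or to the left of [j] (a 123). Hence
    the only possible ascent is at the minimum, and the permutation is a
    decreasing run ending at the minimum followed by a second decreasing run.
    It is determined by the set of values in the second run, i.e. by a binary
    sequence [a] indexed by the non-minimal values. If [a] has [s] ones then
    [afterone = s], [inv + n s = s^2 + binomial(n, 2) + inv a], and [lrmax] is
    [2] or [1] according to whether the largest value is in the second run. *)

(** * Structure of the permutations: two decreasing runs *)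

(** The boolean equation says that both positions lie in the same run; strictness puts the minimum
    itself into the first. *)
Definition two_runs n (p : 'S_n.+1) : Prop :=
  forall i j : 'I_n.+1, (i < j)%N ->
    ((p^-1)%g ord0 < i)%N = ((p^-1)%g ord0 < j)%N -> (p j < p i)%N.

Definition second_run n (p : 'S_n.+1) : {ffun 'I_n -> bool} :=
  [ffun u => ((p^-1)%g ord0 < (p^-1)%g (lift ord0 u))%N].

Lemma fishburn123_descent n (p : 'S_n.+1) (i j : 'I_n.+1) :
  p \in fishburn123 n.+1 -> j = i.+1 :> nat -> p i != ord0 -> (p j < p i)%N.
Proof.
rewrite inE => /andP[fish av] ji pi0; rewrite ltnNge; apply/negP => le_ij.
have lt_ij : (p i < p j)%N.
  rewrite ltn_neqAle le_ij andbT; apply/negP => /eqP/val_inj/perm_inj ij.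
  by move: ji; rewrite ij; lia.
have pi_gt0 : (0 < p i)%N by move: pi0; rewrite -val_eqE /= lt0n.
have lt_pred : ((p i).-1 < n.+1)%N by have := ltn_ord (p i); lia.
pose k := (p^-1)%g (Ordinal lt_pred).
have pk : p k = (p i).-1 :> nat by rewrite permKV.
have [jk|] := ltnP j k.
  case/negP: fish; apply/existsP; exists i; apply/existsP; exists j.
  by apply/existsP; exists k; rewrite ji eqxx -ji jk lt_ij pk prednK ?eqxx.
have ki : k != i by apply/eqP => ki; move: pk; rewrite ki; lia.
have kj : k != j by apply/eqP => kj; move: pk; rewrite kj; lia.
move: ki kj; rewrite -!val_eqE /= => ki kj le_kj.
case/negP: av; apply/existsP; exists k; apply/existsP; exists i.
by apply/existsP; exists j; rewrite lt_ij pk; apply/and4P; split=> //; lia.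
Qed.

Lemma fishburn123P n (p : 'S_n.+1) :
  reflect (two_runs n p) (p \in fishburn123 n.+1).
Proof.
apply: (iffP idP) => [Fp i j|runs].
  case: j => j jn /= ij; elim: j jn ij => // j IHj jn ij same.
  have jn' : (j < n.+1)%N by lia.
  have desc : (p (Ordinal jn) < p (Ordinal jn'))%N.
    (* A minimum at [j] would separate position [j.+1] from all positions up to [j], against
       [same]. *)
    apply: fishburn123_descent Fp _ _ => //; apply/eqP => pj0.
    have ej : j = (p^-1)%g ord0 :> nat by rewrite -pj0 permK.
    by move: same; rewrite -ej; lia.
  have [ij'|] := ltnP i j; last first.
    move=> ji; suff -> : i = Ordinal jn' by [].
    by apply: val_inj => /=; lia.
  by apply: ltn_trans desc (IHj jn' ij' _); lia.
rewrite inE; apply/andP; split; apply/negP.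
  case/existsP=> i /existsP[j /existsP[k /and4P[/eqP ji jk /eqP pik lt_ij]]].
  have : i != (p^-1)%g ord0.
    by apply/eqP => i0; move: pik; rewrite i0 permKV.
  rewrite -val_eqE /= => i0.
  by have := runs i j; rewrite ji; lia.
(* Three positions in two runs: [i, j] or [j, k] share a run, which decreases. *)
case/existsP=> i /existsP[j /existsP[k /and4P[ij jk lt_ij lt_jk]]].
by have := runs i j ij; have := runs j k jk; lia.
Qed.

(* Membership in the second run, with the minimum in the first run. *)
Definition late n (a : {ffun 'I_n -> bool}) (v : 'I_n.+1) : bool :=
  oapp a false (unlift ord0 v).

Lemma late0 n (a : {ffun 'I_n -> bool}) : late n a ord0 = false.
Proof. by rewrite /late unlift_none. Qed.

Lemma late_lift n (a : {ffun 'I_n -> bool}) u : late n a (lift ord0 u) = a u.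
Proof. by rewrite /late liftK. Qed.

Lemma late_second_run n (p : 'S_n.+1) v :
  late n (second_run n p) v = ((p^-1)%g ord0 < (p^-1)%g v)%N.
Proof.
have [u ->|->] := unliftP ord0 v; first by rewrite late_lift ffunE.
by rewrite late0 ltnn.
Qed.

(* Sorting the values by this key puts them in the order in which they appear
   in the permutation. *)
Definition run_key n (a : {ffun 'I_n -> bool}) (v : 'I_n.+1) : nat :=
  n - v + late n a v * n.+1.

(** As [n - v] is at most [n], the shift by [n.+1] keeps the keys of the two runs apart. *)
Lemma run_key_inj n (a : {ffun 'I_n -> bool}) : injective (run_key n a).
Proof.
move=> u v; rewrite /run_key => e; apply: val_inj => /=.
have := ltn_ord u; have := ltn_ord v; move: e.
by case: (late n a u); case: (late n a v); lia.
Qed.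

(** Makes the order of positions depend on [second_run] alone; injectivity and the inversion count
    both rest on this. *)
Lemma two_runs_key n (p : 'S_n.+1) u v : two_runs n p ->
  ((p^-1)%g u < (p^-1)%g v)%N =
    (run_key n (second_run n p) u < run_key n (second_run n p) v)%N.
Proof.
move=> runs; have [->|neq_uv] := eqVneq u v; first by rewrite !ltnn.
have neq_pos : (p^-1)%g u != (p^-1)%g v by rewrite (inj_eq perm_inj).
have := runs ((p^-1)%g u) ((p^-1)%g v); have := runs ((p^-1)%g v) ((p^-1)%g u).
move: neq_pos; rewrite -val_eqE !permKV /run_key !late_second_run /=.
by have := ltn_ord u; have := ltn_ord v; lia.
Qed.

(** * Ranks, sorting and the bijection with binary sequences *)

Lemma card_set_sum (T : finType) (P : pred T) :
  #|[set x | P x]| = (\sum_x P x)%N.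
Proof. by rewrite cardsE -sum1_card big_mkcond. Qed.

Lemma card_set_sum2 (T : finType) (P : rel T) :
  #|[set x : T * T | P x.1 x.2]| = (\sum_x \sum_y P x y)%N.
Proof. by rewrite card_set_sum pair_big. Qed.

Lemma sum_below_ord n (v : 'I_n) : (\sum_(i < n) (i < v) = v)%N.
Proof.
rewrite -[RHS]card_ord -[RHS]sum1_card.
by rewrite (big_ord_widen n (fun=> 1%N) (ltnW (ltn_ord v))) [RHS]big_mkcond.
Qed.

(** Recovers a permutation from the comparisons between its values. *)
Lemma ord_rank n (s : 'S_n) v : s v = #|[set w | (s w < s v)%N]| :> nat.
Proof.
rewrite -(card_imset _ (@perm_inj _ s)).
have -> : s @: [set w | (s w < s v)%N] = [set i : 'I_n | (i < s v)%N].
  apply/setP => i; rewrite inE; apply/imsetP/idP => [[w]|iv].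
    by rewrite inE => ? ->.
  by exists ((s^-1)%g i); rewrite ?inE permKV.
by rewrite card_set_sum sum_below_ord.
Qed.

(** The permutation sends [v] to the number of elements with a smaller key. *)
Lemma ord_sort n (key : 'I_n -> nat) : injective key ->
  exists s : 'S_n, forall u v, (s u < s v)%N = (key u < key v)%N.
Proof.
move=> key_inj; pose below v := [set w | (key w < key v)%N].
have below_mono u v : (key u < key v)%N -> (#|below u| < #|below v|)%N.
  move=> uv; apply/proper_card/properP; split.
    by apply/subsetP => w; rewrite !inE => wu; apply: ltn_trans uv.
  by exists u; rewrite !inE // ltnn.
have rank_lt v : (#|below v| < n)%N.
  rewrite -[X in (_ < X)%N](card_ord n) -cardsT; apply/proper_card/properP; split.
    exact: subsetT.
  by exists v; rewrite !inE // ltnn.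
pose rank v := Ordinal (rank_lt v).
have rankE u v : (rank u < rank v)%N = (key u < key v)%N.
  apply/idP/idP => [|/below_mono //]; rewrite /rank /= => uv.
  case: (ltngtP (key u) (key v)) => // [/below_mono vu|/key_inj e].
    by rewrite ltnNge ltnW in uv.
  by rewrite e ltnn in uv.
have rank_inj : injective rank.
  move=> u v e; apply: key_inj.
  by have := rankE u v; have := rankE v u; rewrite e ltnn; lia.
by exists (perm rank_inj) => u v; rewrite !permE.
Qed.

Lemma second_run_inj n : {in fishburn123 n.+1 &, injective (second_run n)}.
Proof.
move=> p p' /fishburn123P runs /fishburn123P runs' e.
suff e_inv : (p^-1 = p'^-1)%g by rewrite -[p]invgK e_inv invgK.
apply/permP => v; apply: val_inj; rewrite /= (ord_rank _ p^-1%g) (ord_rank _ p'^-1%g).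
by apply: eq_card => w; rewrite !inE !two_runs_key // e.
Qed.

Lemma second_run_surj n : second_run n @: fishburn123 n.+1 = setT.
Proof.
apply/setP => a; rewrite inE; apply/imsetP.
have [s sE] := ord_sort n.+1 _ (run_key_inj n a).
(* [s] sends values to positions, so the permutation sought is its inverse. *)
exists (s^-1)%g.
  apply/fishburn123P => i j; rewrite invgK => ij.
  have := sE ((s^-1)%g i) ((s^-1)%g j); have := sE ord0 ((s^-1)%g i).
  have := sE ord0 ((s^-1)%g j); rewrite !permKV ij /run_key late0 /=.
  have := ltn_ord ((s^-1)%g i); have := ltn_ord ((s^-1)%g j).
  by case: (late n a ((s^-1)%g i)); case: (late n a ((s^-1)%g j)); lia.
apply/ffunP => u; rewrite ffunE invgK sE /run_key late0 late_lift lift0 /=.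
by have := ltn_ord u; case: (a u); lia.
Qed.

Lemma sum_fishburn123 (R : nmodType) n (F : {ffun 'I_n -> bool} -> R) :
  \sum_(p in fishburn123 n.+1) F (second_run n p) = \sum_a F a.
Proof.
rewrite -(big_imset F (second_run_inj n)) second_run_surj.
by apply: eq_bigl => a; rewrite inE.
Qed.

(** * The three statistics read off the binary sequence *)

Lemma binseq_onesE n (a : {ffun 'I_n -> bool}) :
  binseq_ones a = (\sum_i a i)%N.
Proof. exact: card_set_sum. Qed.

Lemma binseq_invE n (a : {ffun 'I_n -> bool}) :
  binseq_inv a = (\sum_(i < n) \sum_(j < n) [&& (i < j)%N, a i & ~~ a j])%N.
Proof. exact: (card_set_sum2 _ (fun i j : 'I_n => [&& (i < j)%N, a i & ~~ a j])). Qed.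

Lemma afterone_second_run n (p : 'S_n.+1) :
  afterone p = binseq_ones (second_run n p).
Proof.
rewrite binseq_onesE.
have -> : afterone p = #|[set i : 'I_n.+1 | ((p^-1)%g ord0 < i)%N]|.
  apply: eq_card => i; rewrite !inE; apply/existsP/idP => [[j /andP[pj]]|i0].
    by rewrite (_ : j = (p^-1)%g ord0) // -(permK p j); congr (_ _); exact/eqP.
  by exists ((p^-1)%g ord0); rewrite permKV i0.
rewrite card_set_sum (reindex_perm (p^-1)%g) big_ord_recl ltnn.
by apply: eq_bigr => u _; rewrite ffunE.
Qed.

Lemma sum_ltn_ord n : (\sum_(i < n) \sum_(j < n) (i < j) = 'C(n, 2))%N.
Proof.
rewrite exchange_big -bin2_sum big_mkord; apply: eq_bigr => j _.
exact: sum_below_ord.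
Qed.

(** With [s] ones there are [s * (n - s)] pairs of a one and a zero, in either order; moving [s ^ 2]
    across avoids subtraction. *)
Lemma binseq_crossings n (a : {ffun 'I_n -> bool}) :
  (binseq_inv a + \sum_(i < n) \sum_(j < n) [&& (i < j)%N, ~~ a i & a j] +
     binseq_ones a ^ 2 = binseq_ones a * n)%N.
Proof.
have -> : (\sum_(i < n) \sum_(j < n) [&& (i < j)%N, ~~ a i & a j] =
           \sum_(i < n) \sum_(j < n) [&& (j < i)%N, a i & ~~ a j])%N.
  rewrite exchange_big; apply: eq_bigr => i _; apply: eq_bigr => j _.
  by rewrite [X in (_ && X)%N]andbC.
rewrite binseq_invE -big_split /= binseq_onesE -mulnn big_distrl /=.
rewrite [in RHS]big_distrl /= -big_split; apply: eq_bigr => i _ /=.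
rewrite -big_split big_distrr -big_split /=.
transitivity (\sum_(j < n) a i)%N; last by rewrite sum_nat_const card_ord mulnC.
apply: eq_bigr => j _; case: (ltngtP i j) => [ij|ij|/val_inj ->].
- by case: (a i); case: (a j).
- by case: (a i); case: (a j).
- by case: (a j).
Qed.

(** Values [u < v] fail to form an inversion exactly when [u] is in the first run and [v] in the
    second. *)
Lemma num_inv_second_run n (p : 'S_n.+1) : two_runs n p ->
  let a := second_run n p in let s := binseq_ones a in
  (num_inv p + n.+1 * s = s ^ 2 + 'C(n.+1, 2) + binseq_inv a)%N.
Proof.
move=> runs a s.
have total : (num_inv p +
    \sum_(u < n.+1) \sum_(v < n.+1) [&& (u < v)%N, ~~ late n a u & late n a v] =
    'C(n.+1, 2))%N.
  rewrite /num_inv.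
  rewrite (card_set_sum2 _ (fun i j : 'I_n.+1 => (i < j)%N && (p j < p i)%N)).
  rewrite (reindex_perm (p^-1)%g) /=.
  under eq_bigr => u _ do rewrite (reindex_perm (p^-1)%g) /=.
  rewrite -big_split -sum_ltn_ord [in RHS](reindex_perm (p^-1)%g) /=.
  apply: eq_bigr => u _; rewrite [in RHS](reindex_perm (p^-1)%g) -big_split /=.
  apply: eq_bigr => v _; rewrite !permKV.
  have [->|] := eqVneq u v; first by rewrite !ltnn.
  rewrite -val_eqE (two_runs_key _ _ _ _ runs) /run_key -/a /=.
  have := ltn_ord u; have := ltn_ord v.
  by case: (late n a u); case: (late n a v); case: (ltngtP u v); lia.
(* The minimum forms such a pair with each of the [s] values of the second run. *)
have split0 :
    (\sum_(u < n.+1) \sum_(v < n.+1) [&& (u < v)%N, ~~ late n a u & late n a v] =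
     s + \sum_(i < n) \sum_(j < n) [&& (i < j)%N, ~~ a i & a j])%N.
  rewrite big_ord_recl big_ord_recl late0 /= add0n; congr (_ + _)%N.
    by rewrite /s binseq_onesE; apply: eq_bigr => v _; rewrite late_lift.
  apply: eq_bigr => u _; rewrite big_ord_recl late0 !andbF add0n.
  by apply: eq_bigr => v _; rewrite !late_lift.
have := binseq_crossings n a; rewrite -/s mulSn mulnC; move: total; rewrite split0.
by lia.
Qed.

(* In a permutation made of two decreasing runs the left-to-right maxima are
   exactly the first entry and the largest entry, which may coincide. *)
Lemma lrmax_second_run n (p : 'S_n.+2) : two_runs n.+1 p ->
  lrmax p = (second_run n.+1 p ord_max).+1.
Proof.
move=> runs; pose m := (p^-1)%g ord_max.
have pm : p m = n.+1 :> nat by rewrite permKV.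
have le_pm i : (p i <= p m)%N by rewrite pm -ltnS.
have -> : lrmax p = #|[set ord0; m]|.
  apply: eq_card => i; rewrite !inE; apply/forallP/idP => [rec|].
    have recE (j : 'I_n.+2) : (j < i)%N -> (p j < p i)%N by move/implyP: (rec j).
    rewrite -!val_eqE /=.
    (* A record [i] other than [ord0] lies in the second run; [m] cannot precede it, nor follow it
       in that decreasing run. *)
    have := runs i m; have := runs ord0 i; have := recE ord0; have := recE m.
    by have := le_pm i; rewrite /=; lia.
  case/orP=> /eqP -> j; apply/implyP => // jm.
  rewrite ltn_neqAle le_pm andbT; apply/negP => /eqP/val_inj/perm_inj e.
  by rewrite e ltnn in jm.
rewrite cards2 ffunE.
have -> : lift ord0 ord_max = ord_max :> 'I_n.+2 by apply: val_inj.
rewrite -/m -val_eqE /=; congr (nat_of_bool _).+1.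
by have := runs ord0 m; have := le_pm ord0; rewrite /=; lia.
Qed.

(** * Splitting off the last bit, and sums of q-binomials *)

(** The last bit gives the run of the largest value, so it separates the terms in [t] and
    [t ^+ 2]. *)
Definition binseq_rcons n (x : {ffun 'I_n -> bool} * bool) :
  {ffun 'I_n.+1 -> bool} := [ffun i => oapp x.1 x.2 (unlift ord_max i)].

Lemma binseq_rcons_max n x : binseq_rcons n x ord_max = x.2.
Proof. by rewrite ffunE unlift_none. Qed.

Lemma binseq_rcons_widen n x i :
  binseq_rcons n x (widen_ord (leqnSn n) i) = x.1 i.
Proof.
rewrite ffunE (_ : widen_ord _ i = lift ord_max i) ?liftK //.
by apply: val_inj; rewrite /= /bump leqNgt ltn_ord.
Qed.

Lemma binseq_rcons_bij n : bijective (binseq_rcons n).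
Proof.
exists (fun a : {ffun 'I_n.+1 -> bool} => ([ffun i => a (lift ord_max i)], a ord_max))
  => [[a b]|a].
  by rewrite binseq_rcons_max; congr (_, _); apply/ffunP => i; rewrite !ffunE liftK.
by apply/ffunP => i; rewrite ffunE; case: unliftP => [j ->|->] //=; rewrite ffunE.
Qed.

Lemma binseq_ones_rcons n x :
  binseq_ones (binseq_rcons n x) = (binseq_ones x.1 + x.2)%N.
Proof.
rewrite !binseq_onesE big_ord_recr binseq_rcons_max; congr (_ + _)%N.
by apply: eq_bigr => i _; rewrite binseq_rcons_widen.
Qed.

(** A final zero is inverted with every earlier one, a final one with nothing. *)
Lemma binseq_inv_rcons n x :
  binseq_inv (binseq_rcons n x) = (binseq_inv x.1 + ~~ x.2 * binseq_ones x.1)%N.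
Proof.
rewrite !binseq_invE big_ord_recr [X in (_ + X = _)%N]big1 => [|j _]; last first.
  by rewrite /= ltnNge -ltnS ltn_ord.
rewrite /= addn0 binseq_onesE big_distrr -big_split; apply: eq_bigr => i _ /=.
rewrite big_ord_recr /= binseq_rcons_max !binseq_rcons_widen ltn_ord /=.
congr (_ + _)%N; last by case: (x.1 i); case: x.2.
by apply: eq_bigr => j _; rewrite binseq_rcons_widen.
Qed.

Lemma sum_binseq_qbinomial (R : comNzRingType) (q : R) n (F : nat -> R) :
  \sum_(a : {ffun 'I_n -> bool}) q ^+ binseq_inv a * F (binseq_ones a) =
  \sum_(0 <= s < n.+1) qbinomial q n s * F s.
Proof.
rewrite big_mkord.
have ones_lt (a : {ffun 'I_n -> bool}) : (binseq_ones a < n.+1)%N.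
  by rewrite ltnS -[X in (_ <= X)%N](card_ord n) max_card.
rewrite (partition_big (fun a => Ordinal (ones_lt a)) predT) //=.
apply: eq_bigr => s _; rewrite big_distrl /=.
by apply: eq_big => [a|a /eqP <-].
Qed.

Theorem proposition4p7 (R : comNzRingType) (q t r : R) (n : nat) (hn : (2 <= n)%N) :
  \sum_(p in fishburn123 n) q ^+ num_inv p * t ^+ lrmax p * r ^+ afterone p =
    t * (\sum_(0 <= s < (n - 2).+1)
           q ^+ (s ^ 2 + s + 'C(n, 2) - n * s)%N * qbinomial q (n - 2) s * r ^+ s)
    + t ^+ 2 * (\sum_(1 <= s < n)
           q ^+ (s ^ 2 + 'C(n, 2) - n * s)%N * qbinomial q (n - 2) (s - 1) * r ^+ s)
  /\
  \sum_(p in fishburn123 n) q ^+ num_inv p * r ^+ afterone p =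
    \sum_(0 <= s < n)
      q ^+ (s ^ 2 + 'C(n, 2) - n * s)%N * qbinomial q (n - 1) s * r ^+ s.
Proof.
case: n hn => [|[|n]] // _; rewrite !subSS !subn0.
pose e s := (s ^ 2 + 'C(n.+2, 2) - n.+2 * s)%N.
have invE p : p \in fishburn123 n.+2 ->
    num_inv p = (binseq_inv (second_run n.+1 p) +
                 e (binseq_ones (second_run n.+1 p)))%N.
  move=> /fishburn123P/num_inv_second_run /=.
  by have := qexp_no_truncation n.+2 (binseq_ones (second_run n.+1 p)); rewrite /e; lia.
split; last first.
  pose F s := q ^+ e s * r ^+ s.
  transitivity (\sum_(a : {ffun 'I_n.+1 -> bool}) q ^+ binseq_inv a * F (binseq_ones a)).
    rewrite -sum_fishburn123; apply: eq_bigr => p Fp.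
    by rewrite invE // afterone_second_run exprD /F mulrA.
  by rewrite sum_binseq_qbinomial; apply: eq_bigr => s _; rewrite /F mulrCA mulrA.
pose F (a : {ffun 'I_n.+1 -> bool}) := q ^+ (binseq_inv a + e (binseq_ones a)) *
  t ^+ (a ord_max).+1 * r ^+ binseq_ones a.
transitivity (\sum_a F a).
  rewrite -sum_fishburn123; apply: eq_bigr => p Fp.
  by rewrite invE // afterone_second_run lrmax_second_run //; apply/fishburn123P.
rewrite (reindex _ (onW_bij _ (binseq_rcons_bij n))) /=.
rewrite -(pair_big predT predT (fun a b => F (binseq_rcons n (a, b)))) /=.
under eq_bigr => a _ do rewrite big_bool /= addrC /F !binseq_rcons_max
  !binseq_ones_rcons !binseq_inv_rcons /= mul1n mul0n !addn0.
rewrite big_split /=; congr (_ + _).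
  (* Last bit zero: it adds [s] inversions, hence the extra [s] in the exponent. *)
  pose G s := t * (q ^+ (s + e s) * r ^+ s).
  rewrite (eq_bigr (fun a => q ^+ binseq_inv a * G (binseq_ones a))) => [|a _].
    rewrite sum_binseq_qbinomial big_distrr; apply: eq_bigr => s _ /=.
    rewrite /G (_ : (s + e s = s ^ 2 + s + 'C(n.+2, 2) - n.+2 * s)%N); first by ring.
    by have := qexp_no_truncation n.+2 s; rewrite /e; lia.
  by rewrite /G -addnA exprD expr1; ring.
(* Last bit one: [s] counts the ones before it, so the summation index is shifted by one. *)
pose G s := t ^+ 2 * (q ^+ e s.+1 * r ^+ s.+1).
rewrite (eq_bigr (fun a => q ^+ binseq_inv a * G (binseq_ones a))) => [|a _].
  rewrite sum_binseq_qbinomial big_distrr big_add1; apply: eq_bigr => s _ /=.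
  by rewrite /G subSS subn0 /e; ring.
by rewrite /G !addn1 exprD; ring.
Qed.
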